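(* Let $\mu>0$ be any real number. Then the function $\Theta(\theta)=(\sin\theta)^\mu$ satisfies the polar equation $$\frac{1}{\sin\theta}\frac{d}{d\theta}\left(\sin\theta\,\frac{d\Theta}{d\theta}\right)+\left[\lambda-\frac{\mu^2}{\sin^2\theta}\right]\Theta=0\qquad\text{on }0<\theta<\pi$$ with $\lambda=\mu(\mu+1)$ (that is, $\lambda=\nu(\nu+1)$ with $\nu=\mu$), and it is bounded at both poles, with $\Theta(\theta)\to0$ as $\theta\to0^+$ and as $\theta\to\pi^-$.
   Context: The displayed equation is the associated Legendre equation of (possibly non-integer) order $\mu$ in the variable $\theta$, with separation constant $\lambda\in\mathbb{R}$. *)

(* Defs.v *)
From HB Require Import structures.
From mathcomp Require Import all_boot all_order all_algebra.
From mathcomp Require Import all_classical all_reals all_analysis.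
Set Implicit Arguments.
Unset Strict Implicit.
Unset Printing Implicit Defensive.
Import Order.TTheory GRing.Theory Num.Theory.
Import numFieldNormedType.Exports.
Local Open Scope classical_set_scope.
Local Open Scope ring_scope.

(* [derive1] is total, so the existence of both derivatives occurring in the
   equation is part of being a solution. *)
Definition polar_equation (R : realType) (mu lambda : R) (Theta : R -> R) :=
  forall theta : R, 0 < theta < pi ->
    let flux := fun t : R => sin t * derive1 Theta t in
    [/\ derivable Theta theta 1,
        derivable flux theta 1 &
        1 / sin theta * derive1 flux theta
          + (lambda - mu ^+ 2 / sin theta ^+ 2) * Theta theta = 0].

(* Main.v *)
(* With S = sin^mu the flux sin * S' is mu * sin^mu * cos, free of the shifted
   exponent mu - 1; differentiating it once more, cos^2 = 1 - sin^2 turns the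
   equation into an identity. At the poles sin tends to 0 from above, so
   sin^mu tends to 0 because mu > 0, and boundedness follows from convergence. *)
Require Import Defs.
From HB Require Import structures.
From mathcomp Require Import all_boot all_order all_algebra.
From mathcomp Require Import all_classical all_reals all_analysis.
From mathcomp Require Import ring.
Import Order.TTheory GRing.Theory Num.Theory.
Import numFieldNormedType.Exports.
Local Open Scope classical_set_scope.
Local Open Scope ring_scope.

(** Differentiation produces the exponent [p - 1]; this brings both powers to one atom, so that
    [ring] and [field] can compare them. *)
Lemma powR_pred (R : realType) (a p : R) : 0 < a -> a `^ p = a `^ (p - 1) * a.
Proof.
move=> a0; rewrite -[X in _ * X](powRr1 (ltW a0)) -powRD ?subrK//.
by rewrite (gt_eqF a0) implybT.
Qed.

Lemma is_derive_sin_powR (R : realType) (mu x : R) : 0 < sin x ->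
  is_derive x 1 (fun t : R => sin t `^ mu) (mu * sin x `^ (mu - 1) * cos x).
Proof.
move=> s0; exact: (is_derive1_comp (is_derive1_powR mu s0) (is_derive_sin x)).
Qed.

Lemma near_sin_gt0 (R : realType) (x : R) : 0 < x < pi ->
  \forall t \near x, 0 < sin t.
Proof.
case/andP=> x0 xpi; near=> t; apply: sin_gt0_pi; apply/andP; split.
  by near: t; exact: lt_nbhsr.
by near: t; exact: lt_nbhsl.
Unshelve. all: by end_near. Qed.

Lemma flux_sin_powR (R : realType) (mu t : R) : 0 < sin t ->
  sin t * derive1 (fun u : R => sin u `^ mu) t = mu * (sin t `^ mu * cos t).
Proof.
move=> s0; rewrite derive1E (derive_val (is_derive := is_derive_sin_powR _ mu t s0)).
rewrite (powR_pred _ _ mu s0); ring.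
Qed.

Lemma is_derive_flux_sin_powR (R : realType) (mu x : R) : 0 < x < pi ->
  is_derive x 1
    (fun t : R => sin t * derive1 (fun u : R => sin u `^ mu) t)
    (mu * (mu * sin x `^ (mu - 1) * cos x ^+ 2 - sin x `^ mu * sin x)).
Proof.
move=> x0pi; have s0 := sin_gt0_pi x0pi.
(* The closed form of the flux holds only where [sin] is positive; agreement near [x] is enough for
   the derivative. *)
apply: (@near_eq_is_derive _ _ _
  (fun t : R => mu * (sin t `^ mu * cos t))) => //.
  near=> t; rewrite flux_sin_powR//; near: t; exact: near_sin_gt0.
have dS := is_derive_sin_powR R mu x s0.
apply: (@is_derive_eq _ _ _ (mu *: ((fun t : R => sin t `^ mu) * cos))).
rewrite /GRing.scale/=; ring.
Unshelve. all: by end_near. Qed.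

(** The filter is arbitrary so that both poles are covered. Positivity refines the limit of [sin] to
    [0^'+], where the one-sided limit of the power applies. *)
Lemma cvg_sin_powR0 (R : realType) (mu : R) (F : set_system R)
    (FF : Filter F) : 0 < mu ->
  sin x @[x --> F] --> (0 : R) -> (\forall x \near F, 0 < sin x) ->
  sin x `^ mu @[x --> F] --> (0 : R).
Proof.
move=> mu0 sin0 sin_gt0.
have sin0r : sin x @[x --> F] --> (0 : R)^'+.
  move=> P /sin0 /= P0; rewrite /fmap/=.
  by apply: filterS2 sin_gt0 P0 => x s0; apply.
exact: (cvg_comp _ _ sin0r (powR_cvg0 mu0)).
Qed.

Theorem mainTheorem4 (R : realType) (mu : R) (mu_gt0 : 0 < mu) :
  let Theta := fun theta : R => sin theta `^ mu in
  [/\ polar_equation mu (mu * (mu + 1)) Theta,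
      bounded_near Theta 0^'+,
      bounded_near Theta pi^'-,
      Theta theta @[theta --> 0^'+] --> 0 &
      Theta theta @[theta --> pi^'-] --> 0].
Proof.
move=> Theta.
have pi0 : 0 < pi :> R := pi_gt0 R.
have lim0 : Theta theta @[theta --> 0^'+] --> 0.
  apply: cvg_sin_powR0 => //.
    (* Reading the limit 0 as [sin 0] reduces the claim to continuity of [sin]. *)
    rewrite -[X in _ --> X](@sin0 R); apply: cvg_at_right_filter.
    exact: continuous_sin.
  by near=> t; apply: sin_gt0_pi; apply/andP; split.
have limpi : Theta theta @[theta --> pi^'-] --> 0.
  apply: cvg_sin_powR0 => //.
    rewrite -[X in _ --> X](@sinpi R); apply: cvg_at_left_filter.
    exact: continuous_sin.
  by near=> t; apply: sin_gt0_pi; apply/andP; split.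
split=> //; [|exact: cvg_bounded lim0|exact: cvg_bounded limpi].
move=> x x0pi flux; have s0 := sin_gt0_pi x0pi.
have dS := is_derive_sin_powR R mu x s0.
have dF := is_derive_flux_sin_powR R mu x x0pi.
split; [by case: dS|by case: dF|].
rewrite derive1E (derive_val (is_derive := dF)) /Theta cos2sin2.
(* What remains is a rational identity in [mu], [sin x] and the power with exponent [mu - 1], with
   only [sin x] in denominators. *)
rewrite (powR_pred _ _ mu s0).
field; exact: lt0r_neq0.
Unshelve. all: by end_near. Qed.
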